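(* Let $G:\ell^1\to\ell^\infty$ be the linear operator defined by $G(x)=y$, where $y_n=\sum_{i=n+1}^{\infty}x_i-\sum_{i=1}^{n-1}x_i$ for $n=1,2,\dots$, and let $T:c_0\rightrightarrows\ell^1$ be the point-to-set operator $T(x)=\{y\in\ell^1 \mid -G(y)=x\}$ for $x\in c_0$. Then $T$ has infinitely many maximal monotone extensions to $\ell^\infty\rightrightarrows\ell^1$, i.e., there are infinitely many distinct maximal monotone operators $S:\ell^\infty\rightrightarrows\ell^1$ (maximal monotone in $\ell^\infty\times\ell^1$) with $\operatorname{Gr}(T)\subset\operatorname{Gr}(S)$. In particular, $T$ is not of Gossez type (D).
   Context: All spaces are real; sequences are indexed by $1,2,\dots$. $c_0$ is the space of real sequences converging to $0$ and $\ell^\infty$ the space of bounded real sequences, both with the sup-norm; $\ell^1$ is the space of absolutely summable real sequences with the $1$-norm. The dual $c_0^*$ is identified with $\ell^1$ and $(\ell^1)^*=c_0^{**}$ with $\ell^\infty$, via $\langle x,y\rangle=\sum_{i=1}^\infty x_iy_i$; $c_0$ is regarded as a subspace of $\ell^\infty$. A point-to-set operator $T:U\rightrightarrows V$ is a map from $U$ to the power set of $V$; its graph is $\operatorname{Gr}(T)=\{(u,v)\in U\times V \mid v\in T(u)\}$. Let $X$ be a real Banach space, identified with its canonical image in $X^{**}$. An operator $T:X\rightrightarrows X^*$ is monotone if $\langle x-y,x^*-y^*\rangle\ge 0$ for all $(x,x^* ),(y,y^* )\in\operatorname{Gr}(T)$. An operator $S:X^{**}\rightrightarrows X^*$ is monotone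 if $\langle x^*-y^*,x^{**}-y^{**}\rangle\ge0$ for all $(x^{**},x^* ),(y^{**},y^* )\in\operatorname{Gr}(S)$. A monotone operator is maximal monotone (in $X\times X^*$, respectively $X^{**}\times X^*$) if its graph is maximal with respect to inclusion among graphs of monotone operators in $X\times X^*$ (respectively $X^{**}\times X^*$). Gossez's monotone closure of a maximal monotone $T:X\rightrightarrows X^*$ is the operator $\widetilde T:X^{**}\rightrightarrows X^*$ with graph $\operatorname{Gr}(\widetilde T)=\{(x^{**},x^* )\in X^{**}\times X^* \mid \langle x^*-y^*,x^{**}-y\rangle\ge 0\ \ \forall (y,y^* )\in\operatorname{Gr}(T)\}$. A maximal monotone $T:X\rightrightarrows X^*$ is of Gossez type (D) if for every $(x^{**},x^* )\in\operatorname{Gr}(\widetilde T)$ there is a bounded net $((x_i,x_i^* ))_{i\in I}$ in $\operatorname{Gr}(T)$ converging to $(x^{**},x^* )$ in the $\sigma(X^{**},X^* )\times$strong topology of $X^{**}\times X^*$ (i.e., $x_i\to x^{**}$ weak-$*$ in $X^{**}$ and $x_i^*\to x^*$ in norm). Here these notions are applied with $X=c_0$, $X^*=\ell^1$, $X^{**}=\ell^\infty$; the operator $T$ of the claim is maximal monotone in $c_0\times\ell^1$. *)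

(* Defs.v *)
From HB Require Import structures.
From mathcomp Require Import all_boot all_order all_algebra.
From mathcomp Require Import all_classical all_reals all_analysis.
From mathcomp Require Import ring lra.

Set Implicit Arguments.
Unset Strict Implicit.
Unset Printing Implicit Defensive.

Import Order.TTheory GRing.Theory Num.Theory.
Import numFieldNormedType.Exports.

Local Open Scope classical_set_scope.
Local Open Scope ring_scope.

(* Sequences are indexed from 0: the entry x_n of the mathematical text is
   [x n.-1] here. *)

Section Linf.
Variable R : realType.

Definition linf_pred : {pred R^nat} := mem [set x : R^nat | bounded_fun x].

Record linf := Linf { linf_seq :> nat -> R; _ : linf_seq \in linf_pred }.

HB.instance Definition _ := [isSub for linf_seq].
HB.instance Definition _ := [Choice of linf by <:].

Lemma linf_predP (x : R^nat) :
  reflect (exists M, forall n, `|x n| <= M) (x \in linf_pred).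
Proof.
apply: (iffP idP); rewrite inE /=.
  move=> bx; have [M _ xM] := pinfty_ex_gt0 bx.
  by exists M => n; exact: xM.
move=> [M xM]; exists M; split; first exact: num_real.
by move=> y My n _ /=; exact: le_trans (xM n) (ltW My).
Qed.

Lemma linf_submod_closed : submod_closed linf_pred.
Proof.
split=> [|a x y /linf_predP[M xM] /linf_predP[N yN]]; apply/linf_predP.
  by exists 0 => n; rewrite normr0.
exists (`|a| * M + N) => n; apply: (le_trans (ler_normD _ _)).
by apply: lerD => //; rewrite normrM ler_wpM2l.
Qed.
HB.instance Definition _ :=
  GRing.isSubmodClosed.Build _ _ linf_pred linf_submod_closed.
HB.instance Definition _ := [SubChoice_isSubLmodule of linf by <:].

Definition linf_norm (x : linf) : R := sup (range (fun n => `|x n|)).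

Lemma linf_has_sup (x : linf) : has_sup (range (fun n => `|x n|)).
Proof.
split; first by exists `|x 0%N|, 0%N.
have /linf_predP[M xM] := valP x.
by exists M => _ [n _ <-]; exact: xM.
Qed.

Lemma linf_norm_ub (x : linf) n : `|x n| <= linf_norm x.
Proof. by apply: ub_le_sup; [case: (linf_has_sup x)|exists n]. Qed.

Lemma linf_norm_le (x : linf) M : (forall n, `|x n| <= M) -> linf_norm x <= M.
Proof.
move=> xM; apply: ge_sup; first by case: (linf_has_sup x).
by move=> _ [n _ <-].
Qed.

Lemma linf_normD x y : linf_norm (x + y) <= linf_norm x + linf_norm y.
Proof.
apply: linf_norm_le => n; apply: (le_trans (ler_normD _ _)).
by apply: lerD; exact: linf_norm_ub.
Qed.

Lemma linf_normZ (a : R) x : linf_norm (a *: x) = `|a| * linf_norm x.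
Proof.
have le b y : linf_norm (b *: y) <= `|b| * linf_norm y.
  apply: linf_norm_le => n; rewrite normrM.
  by apply: ler_wpM2l => //; exact: linf_norm_ub.
apply/le_anti; rewrite le /=.
have [->|a0] := eqVneq a 0.
  by rewrite normr0 mul0r (le_trans (normr_ge0 _) (linf_norm_ub _ 0%N)).
rewrite -ler_pdivlMl ?normr_gt0// -normfV.
by rewrite -[x in leLHS](scalerK a0) le.
Qed.

Lemma linf_norm0 x : linf_norm x = 0 -> x = 0.
Proof.
move=> x0; apply/val_inj/funext => n; apply/eqP.
by rewrite -normr_le0 -x0; exact: linf_norm_ub.
Qed.

HB.instance Definition _ :=
  Lmodule_isNormed.Build R linf linf_normD linf_normZ linf_norm0.

End Linf.

Section C0.
Variable R : realType.

Definition c0_pred : {pred linf R} :=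
  mem [set x : linf R | (x : R^nat) @ \oo --> (0 : R)].

Record c0 := C0 { c0_linf :> linf R; _ : c0_linf \in c0_pred }.

HB.instance Definition _ := [isSub for c0_linf].
HB.instance Definition _ := [Choice of c0 by <:].

Lemma c0_submod_closed : submod_closed c0_pred.
Proof.
split=> [|a x y]; rewrite !inE /=; first exact: cvg_cst.
move=> x0 y0.
have -> : (0 : R) = a * 0 + 0 by rewrite mulr0 addr0.
by apply: cvgD => //; apply: cvgM => //; exact: cvg_cst.
Qed.
HB.instance Definition _ :=
  GRing.isSubmodClosed.Build _ _ c0_pred c0_submod_closed.
HB.instance Definition _ := [SubChoice_isSubLmodule of c0 by <:].

Definition c0_norm (x : c0) : R := `|x : linf R|.

Lemma c0_normD x y : c0_norm (x + y) <= c0_norm x + c0_norm y.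
Proof. exact: ler_normD. Qed.

Lemma c0_normZ (a : R) x : c0_norm (a *: x) = `|a| * c0_norm x.
Proof. exact: normrZ. Qed.

Lemma c0_norm0 x : c0_norm x = 0 -> x = 0.
Proof. by move=> /normr0_eq0 x0; exact: val_inj. Qed.

HB.instance Definition _ :=
  Lmodule_isNormed.Build R c0 c0_normD c0_normZ c0_norm0.

End C0.

Section Ell1.
Variable R : realType.

Definition ell1_pred : {pred R^nat} :=
  mem [set x : R^nat | cvgn (series (fun n => `|x n|))].

Record ell1 := Ell1 { ell1_seq :> nat -> R; _ : ell1_seq \in ell1_pred }.

HB.instance Definition _ := [isSub for ell1_seq].
HB.instance Definition _ := [Choice of ell1 by <:].

Lemma ell1_submod_closed : submod_closed ell1_pred.
Proof.
split=> [|a x y]; rewrite !inE /=.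
  rewrite (_ : series _ = cst 0); first exact: is_cvg_cst.
  by apply/funext => n; rewrite seriesEnat/= big1// => i _; rewrite normr0.
move=> cx cy.
pose u : R^nat := fun n => `|x n|; pose v : R^nat := fun n => `|y n|.
apply: (@series_le_cvg _ _ (`|a| *: u + v)).
- by move=> n.
- by move=> n; exact: addr_ge0 (mulr_ge0 (normr_ge0 a) (normr_ge0 (x n))) (normr_ge0 _).
- by move=> n; apply: (le_trans (ler_normD _ _)); rewrite normrM.
by apply: is_cvg_seriesD => //; exact: is_cvg_seriesZ.
Qed.
HB.instance Definition _ :=
  GRing.isSubmodClosed.Build _ _ ell1_pred ell1_submod_closed.
HB.instance Definition _ := [SubChoice_isSubLmodule of ell1 by <:].

Definition ell1_norm (x : ell1) : R := limn (series (fun n => `|x n|)).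

Lemma ell1_cvg_normed (x : ell1) : cvgn (series (fun n => `|x n|)).
Proof. by have := valP x; rewrite inE. Qed.

Arguments ell1_cvg_normed : clear implicits.

Lemma ell1_cvg (x : ell1) : cvgn (series x).
Proof. by apply: (@normed_cvg _ R^o); exact: ell1_cvg_normed. Qed.

Lemma ell1_normD x y : ell1_norm (x + y) <= ell1_norm x + ell1_norm y.
Proof.
rewrite /ell1_norm -limD; [|exact: ell1_cvg_normed..].
apply: ler_lim; first exact: ell1_cvg_normed.
  by apply: is_cvgD; exact: ell1_cvg_normed.
apply: nearW => n; rewrite fctE seriesEnat/= -big_split /=.
by apply: ler_sum => i _; exact: ler_normD.
Qed.

Lemma ell1_normZ (a : R) x : ell1_norm (a *: x) = `|a| * ell1_norm x.
Proof.
rewrite /ell1_norm.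
have cx := ell1_cvg_normed x.
rewrite -[RHS](@limZl_tmp _ R^o)//.
congr (limn _); apply/funext => n; rewrite fctE seriesEnat/= scaler_sumr.
by apply: eq_bigr => i _; exact: normrM.
Qed.

Lemma ell1_norm0 x : ell1_norm x = 0 -> x = 0.
Proof.
move=> x0; apply/val_inj/funext => n; apply/eqP.
rewrite -normr_le0 -x0.
apply: (@le_trans _ _ (series (fun n => `|x n|) n.+1)).
  by rewrite seriesEnat/= big_nat_recr//= lerDr sumr_ge0.
apply: nondecreasing_cvgn_le; last exact: ell1_cvg_normed.
by apply: nondecreasing_series.
Qed.

HB.instance Definition _ :=
  Lmodule_isNormed.Build R ell1 ell1_normD ell1_normZ ell1_norm0.

End Ell1.

(* The duality product, both between c0 and ell1 = c0^* and between
   ell1 and linf = ell1^*; the series converges absolutely. *)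
Definition pairing {R : realType} (x : linf R) (y : ell1 R) : R :=
  limn (series (fun i => x i * y i)).

Definition graph {U V : Type} (T : U -> set V) : set (U * V) :=
  [set p | T p.1 p.2].

Section Monotone.
Context {R : realType} {U V : zmodType} (dual : U -> V -> R).

Definition monotone_op (T : U -> set V) : Prop :=
  forall p q, graph T p -> graph T q -> 0 <= dual (p.1 - q.1) (p.2 - q.2).

Definition maximal_monotone (T : U -> set V) : Prop :=
  monotone_op T /\
  forall S, monotone_op S -> graph T `<=` graph S -> graph S = graph T.

End Monotone.

Definition maximal_monotone_c0 {R : realType} : (c0 R -> set (ell1 R)) -> Prop :=
  maximal_monotone (fun x : c0 R => pairing x).

Definition maximal_monotone_linf {R : realType} :
  (linf R -> set (ell1 R)) -> Prop := maximal_monotone pairing.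

Definition extends {R : realType} (S : linf R -> set (ell1 R))
    (T : c0 R -> set (ell1 R)) : Prop :=
  [set (c0_linf p.1, p.2) | p in graph T] `<=` graph S.

Definition directed (I : Type) (le : I -> I -> Prop) : Prop :=
  [/\ inhabited I,
      forall i, le i i,
      forall i j k, le i j -> le j k -> le i k &
      forall i j, exists k, le i k /\ le j k].

(* A net indexed by a directed preorder [le] converges to a point when it does
   so along this filter. *)
Definition tails (I : Type) (le : I -> I -> Prop) : set_system I :=
  filter_from [set: I] (fun i => [set j | le i j]).

Definition gossez_closure {R : realType} (T : c0 R -> set (ell1 R)) :
    linf R -> set (ell1 R) :=
  fun x => [set v | forall q, graph T q -> 0 <= pairing (x - q.1) (v - q.2)].

(* This notion is meant for maximal monotone [T] only; maximality is not part of
   the definition, so that the negation says that some element of the closure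
   is not the limit of a bounded net. Weak-* convergence in linf is convergence
   of the products with each [z] in ell1. *)
Definition gossez_type_D {R : realType} (T : c0 R -> set (ell1 R)) : Prop :=
  forall p, graph (gossez_closure T) p ->
  exists (I : Type) (le : I -> I -> Prop) (x : I -> c0 R) (v : I -> ell1 R),
    [/\ directed le,
        forall i, graph T (x i, v i),
        exists M : R, forall i, `|x i| <= M /\ `|v i| <= M,
        forall z : ell1 R,
          pairing (x i) z @[i --> tails le] --> pairing p.1 z &
        v i @[i --> tails le] --> p.2].

Section G.
Variable R : realType.

(* With entries indexed from 0, y_n = sum_(i > n) x_i - sum_(i < n) x_i keeps
   the shape it has with indices starting at 1. *)
Definition G_seq (x : nat -> R) (n : nat) : R :=
  limn (fun N => \sum_(n.+1 <= i < N) x i) - \sum_(0 <= i < n) x i.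

Lemma ell1_tail_cvg (x : ell1 R) n :
  (fun N => \sum_(n <= i < N) x i) @ \oo -->
    limn (series x) - series x n.
Proof.
apply: (@cvg_trans _ ((fun N => series x N - series x n) @ \oo)); last first.
  by apply: cvgB; [exact: ell1_cvg|exact: cvg_cst].
apply: near_eq_cvg; exists n => // N /= nN.
by rewrite sub_series_geq.
Qed.

Lemma G_seqE (x : ell1 R) n :
  G_seq x n = limn (series x) - series x n.+1 - series x n.
Proof. by rewrite /G_seq (cvg_lim _ (@ell1_tail_cvg x n.+1)). Qed.

Lemma G_subproof (x : ell1 R) : G_seq x \in @linf_pred R.
Proof.
rewrite inE /=.
have -> : G_seq x = fun n => limn (series x) - series x n.+1 - series x n.
  by apply/funext => n; exact: G_seqE.
apply: (@cvg_seq_bounded _ R^o).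
have cx := @ell1_cvg _ x.
apply: is_cvgB => //; apply: is_cvgB; first exact: is_cvg_cst.
apply/cvg_ex; exists (limn (series x)).
by have := cx; rewrite -(cvg_shiftS (series x)).
Qed.

Definition G (x : ell1 R) : linf R := Linf (G_subproof x).

Lemma G_is_linear : linear G.
Proof.
move=> a x y; apply/val_inj/funext => n.
have E : (a *: x + y : ell1 R) = a *: (x : nat -> R) + y :> (nat -> R) by [].
change (G_seq (a *: x + y : ell1 R) n = a * G_seq x n + G_seq y n).
rewrite !G_seqE E seriesD seriesZ.
have cx := @ell1_cvg _ x; have cy := @ell1_cvg _ y.
rewrite limD//; last exact: is_cvgZl_tmp.
rewrite limZl_tmp// !fctE /GRing.scale /=.
rewrite !mulrDr !mulrN; ring.
Qed.

HB.instance Definition _ :=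
  GRing.isLinear.Build R (ell1 R) (linf R) _ G G_is_linear.

End G.

Definition gossez_op (R : realType) : c0 R -> set (ell1 R) :=
  fun x => [set y | - G y = x].
Arguments gossez_op : clear implicits.

Section MaximalMonotone.
Variable R : realType.
Implicit Types (x : linf R) (y z : ell1 R).

Lemma pairing_cvg x y : cvgn (series (fun i => x i * y i)).
Proof.
apply: (@normed_cvg _ R^o) => /=.
apply: (@series_le_cvg _ _ (`|x| *: (fun i => `|y i| : R^o))) => [n|n|n|].
- exact: normr_ge0.
- exact: mulr_ge0.
- rewrite /= normrM; apply: ler_wpM2r => //; exact: linf_norm_ub.
- by apply: is_cvg_seriesZ; exact: ell1_cvg_normed.
Qed.
Arguments pairing_cvg : clear implicits.

Lemma pairing_linearl (a : R) x x' y :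
  pairing (a *: x + x') y = a * pairing x y + pairing x' y.
Proof.
rewrite /pairing -[a * _](@lim_seriesZ _ _ a); last exact: pairing_cvg.
rewrite -lim_seriesD; [|exact: is_cvg_seriesZ (pairing_cvg _ _)|exact: pairing_cvg].
congr (limn (series _)); apply/funext => i.
change ((a * x i + x' i) * y i = a * (x i * y i) + x' i * y i); ring.
Qed.

Lemma pairing_linearr (a : R) x y z :
  pairing x (a *: y + z) = a * pairing x y + pairing x z.
Proof.
rewrite /pairing -[a * _](@lim_seriesZ _ _ a); last exact: pairing_cvg.
rewrite -lim_seriesD; [|exact: is_cvg_seriesZ (pairing_cvg _ _)|exact: pairing_cvg].
congr (limn (series _)); apply/funext => i.
change (x i * (a * y i + z i) = a * (x i * y i) + x i * z i); ring.
Qed.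

Lemma pairing0l y : pairing 0 y = 0.
Proof.
have := pairing_linearl 1 0 0 y; rewrite scale1r addr0 mul1r => e.
by apply: (@addrI _ (pairing 0 y)); rewrite -e addr0.
Qed.

Lemma pairing0r x : pairing x 0 = 0.
Proof.
have := pairing_linearr 1 x 0 0; rewrite scale1r addr0 mul1r => e.
by apply: (@addrI _ (pairing x 0)); rewrite -e addr0.
Qed.

Lemma pairingNl x y : pairing (- x) y = - pairing x y.
Proof. by rewrite -[- x]addr0 -scaleN1r pairing_linearl pairing0l mulN1r addr0. Qed.

Lemma pairingBl x x' y : pairing (x - x') y = pairing x y - pairing x' y.
Proof. by rewrite addrC -scaleN1r pairing_linearl mulN1r addrC. Qed.

Lemma pairingBr x y z : pairing x (y - z) = pairing x y - pairing x z.
Proof. by rewrite addrC -scaleN1r pairing_linearr mulN1r addrC. Qed.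

Lemma G_skew y z : pairing (G y) z = - pairing (G z) y.
Proof.
apply/eqP; rewrite -subr_eq0 opprK /pairing -lim_seriesD; [|exact: pairing_cvg..].
apply/eqP; apply: cvg_lim => //.
set A := limn (series y); set B := limn (series z).
have E N : series ((fun i => G y i * z i) + (fun i => G z i * y i)) N =
    A * series z N + B * series y N - 2 * (series y N * series z N).
  elim: N => [|N IH]; first by rewrite !seriesEnat /= !big_geq// !mulr0 !addr0 subr0.
  rewrite seriesSr {}IH /= fctE /G /= !G_seqE !seriesSr -/A -/B; ring.
rewrite (funext E).
have -> : (0 : R) = A * B + B * A - 2 * (A * B) by ring.
have cA : series y @ \oo --> A by exact: ell1_cvg.
have cB : series z @ \oo --> B by exact: ell1_cvg.
apply: cvgB; first by apply: cvgD; apply: cvgM => //; exact: cvg_cst.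
by apply: cvgM; [exact: cvg_cst|exact: cvgM].
Qed.

Lemma G_diag y : pairing (G y) y = 0.
Proof. by have := G_skew y y; lra. Qed.

Lemma G_cvg y : (G y : nat -> R) @ \oo --> - limn (series y).
Proof.
have -> : (G y : nat -> R) = fun n => limn (series y) - series y n.+1 - series y n.
  by apply/funext => n; exact: G_seqE.
set A := limn _; have -> : - A = A - A - A by ring.
have cA : series y @ \oo --> A by exact: ell1_cvg.
apply: cvgB => //; apply: cvgB; first exact: cvg_cst.
by rewrite (cvg_shiftS (series y)).
Qed.

Definition bump_seq (n i : nat) : R := (i == n)%:R - (i == n.+1)%:R.

Lemma bump_sum (u : nat -> R) n N : (n.+2 <= N)%N ->
  \sum_(0 <= i < N) u i * bump_seq n i = u n - u n.+1.
Proof.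
move=> nN; rewrite big_mkord.
have n1 : (n < N)%N by apply: leq_trans nN; rewrite ltnW.
under eq_bigr do rewrite /bump_seq mulrBr.
rewrite sumrB.
rewrite (bigD1 (Ordinal n1))//= eqxx mulr1 big1 ?addr0; last first.
  by move=> i; rewrite -val_eqE /= => /negPf ->; rewrite mulr0.
rewrite (bigD1 (Ordinal nN))//= eqxx mulr1 big1 ?addr0// => i.
by rewrite -val_eqE /= => /negPf ->; rewrite mulr0.
Qed.

Lemma bump_subproof n : bump_seq n \in @ell1_pred R.
Proof.
rewrite inE /=.
apply/cvg_ex; exists (series (fun i => `|bump_seq n i|) n.+2).
apply: cvg_near_cst; exists n.+2 => // N /= nN.
apply/eqP; rewrite -subr_eq0 sub_series_geq// big_nat_cond big1// => i.
rewrite andbT => /andP[ni _]; rewrite /bump_seq !gtn_eqF ?subr0 ?normr0//.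
by apply: leq_trans ni.
Qed.

Definition bump n : ell1 R := Ell1 (bump_subproof n).

Lemma bump_lim (u : nat -> R) n :
  limn (series (fun i => u i * bump n i)) = u n - u n.+1.
Proof.
apply: cvg_lim => //; apply: cvg_near_cst; exists n.+2 => // N /= nN.
by rewrite seriesEnat /= bump_sum.
Qed.

Lemma G_c0 y : limn (series y) = 0 -> - G y \in @c0_pred R.
Proof.
by move=> y0; rewrite rpredN inE /=; have := @G_cvg y; rewrite y0 oppr0.
Qed.

Lemma gossez_op_maximal_monotone : maximal_monotone_c0 (gossez_op R).
Proof.
split=> [[x y] [x' y']|S Smon TS]; rewrite /graph /gossez_op /=.
  move=> e e'. have -> : (x : linf R) - (x' : linf R) = - G (y - y').
    by rewrite -e -e' linearB opprB opprK addrC.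
  by rewrite pairingNl G_diag oppr0.
apply/seteqP; split => //; case=> x0 y0 Sxy /=.
set s := limn (series y0).
pose w : linf R := (x0 : linf R) + G y0.
have key y : limn (series y) = 0 -> pairing w y <= pairing x0 y0.
  move=> y_0; pose x := C0 (G_c0 y_0).
  have Txy : graph (gossez_op R) (x, y) by [].
  have := Smon (x0, y0) (x, y) Sxy (TS _ Txy) => /=.
  rewrite pairingBr !pairingBl !pairingNl G_diag (G_skew y y0).
  have -> : pairing w y = pairing x0 y + pairing (G y0) y.
    by rewrite /w -[x0 : linf R]scale1r pairing_linearl mul1r scale1r.
  lra.
have wb n : pairing w (bump n) = 0.
  have b0 (t : R) : limn (series (t *: bump n)) = 0.
    rewrite seriesZ limZl_tmp; last exact: ell1_cvg.
    rewrite (_ : limn _ = 0) ?scaler0//.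
    rewrite -[RHS](subrr (1 : R)) -(bump_lim (fun=> 1) n).
    by congr (limn (series _)); apply/funext => i; rewrite mul1r.
  have k t : t * pairing w (bump n) <= pairing x0 y0.
    by have := key _ (b0 t); rewrite -[t *: _]addr0 pairing_linearr pairing0r addr0.
  apply/eqP/negP => /negP p0.
  have := k ((pairing x0 y0 + 1) / pairing w (bump n)).
  by rewrite divfK//; lra.
have wS n : w n.+1 = w n.
  by have := wb n; rewrite /pairing bump_lim => /eqP; rewrite subr_eq0 => /eqP.
have w0 n : w n = w 0%N by elim: n => // n <-; exact: wS.
have ws : w 0%N = - s.
  have cw : (w : nat -> R) @ \oo --> - s.
    rewrite -[- s]add0r; apply: cvgD; last exact: G_cvg.
    by have := valP x0; rewrite inE.
  rewrite -(cvg_lim _ cw)//; apply/esym/cvg_lim => //.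
  by rewrite (funext w0); exact: cvg_cst.
have s0 : s = 0.
  have : 0 <= pairing x0 y0.
    rewrite -(pairing0r w); apply: key.
    have -> : series (0 : ell1 R) = cst 0.
      by apply/funext => n; rewrite seriesEnat /= big1.
    exact: lim_cst.
  have -> : pairing x0 y0 = pairing w y0.
    by rewrite /w -[x0 : linf R]scale1r pairing_linearl mul1r scale1r G_diag addr0.
  have -> : pairing w y0 = - s * s.
    rewrite /pairing -[RHS](@lim_seriesZ _ _ (- s)); last exact: ell1_cvg.
    by congr (limn (series _)); apply/funext => i; rewrite w0 ws.
  rewrite mulNr oppr_ge0 -expr2 => s2.
  by apply/eqP; rewrite -sqrf_eq0 eq_le s2 sqr_ge0.
apply/esym/eqP; rewrite -subr_eq0 opprK; apply/eqP/val_inj/funext => n.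
by have := w0 n; rewrite ws s0 oppr0.
Qed.

End MaximalMonotone.

(* Main.v *)
Require Import Defs.
From mathcomp Require Import all_boot all_order all_algebra.
From mathcomp Require Import all_classical all_reals all_analysis.
From mathcomp Require Import ring lra.

Import Order.TTheory GRing.Theory Num.Theory.
Import numFieldNormedType.Exports.

Local Open Scope classical_set_scope.
Local Open Scope ring_scope.

(** Write [e] for the constant sequence 1 and [s y = <e, y>] for the sum of [y].
    Since [G] is skew, the range of [T] is [ker s], and only the multiples of [e]
    annihilate [ker s], a pair [(x, y)] is monotonically related to [T] iff
    [x = - G y + c e] with [0 <= c * s y]; and two such pairs pair to [(c - c') * (s y - s y')].  So a
    maximal monotone graph in the plane through the origin lifts to a maximal
    monotone extension of [T]; the lines [c = k s] give infinitely many.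
    As [s] is continuous and vanishes on the range of [T], the pair [(- G y, y)]
    with [s y = 1] lies in the closure but is no norm limit of values of [T]. *)

Section GossezExtensions.
Variable R : realType.
Implicit Types (x : linf R) (y z : ell1 R).

Lemma linf_one_subproof : (fun=> 1 : R) \in @linf_pred R.
Proof. by apply/linf_predP; exists 1 => n; rewrite normr1. Qed.

Definition linf_one : linf R := Linf linf_one_subproof.

Lemma pairing_one y : pairing linf_one y = limn (series y).
Proof.
by congr (limn (series _)); apply/funext => i; rewrite /= mul1r.
Qed.

Lemma pairingDl x x' y : pairing (x + x') y = pairing x y + pairing x' y.
Proof. by rewrite -[x in LHS]scale1r pairing_linearl mul1r. Qed.

Lemma pairingZl (a : R) x y : pairing (a *: x) y = a * pairing x y.
Proof. by rewrite -[a *: x]addr0 pairing_linearl pairing0l addr0. Qed.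

Lemma pairingZr (a : R) x y : pairing x (a *: y) = a * pairing x y.
Proof. by rewrite -[a *: y]addr0 pairing_linearr pairing0r addr0. Qed.

Lemma ler_norm_pairing_one y : `|pairing linf_one y| <= `|y|.
Proof.
by rewrite pairing_one; apply: lim_series_norm; exact: ell1_cvg_normed.
Qed.

Lemma pairing_bump x n : pairing x (Defs.bump R n) = x n - x n.+1.
Proof. exact: bump_lim. Qed.

(** The [G] terms pair to [- <G (y - z), y - z>], which vanishes by skewness. *)
Lemma pairing_affine (c c' : R) y z :
  pairing ((- G y + c *: linf_one) - (- G z + c' *: linf_one)) (y - z) =
  (c - c') * (pairing linf_one y - pairing linf_one z).
Proof.
rewrite pairingBl !pairingDl !pairingNl !pairingZl !pairingBr !G_diag.
rewrite (G_skew y z); ring.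
Qed.

(** [G y] tends to [- s y], and [x = - G y] lies in [c0]. *)
Lemma gossez_op_sum (x : c0 R) y : gossez_op R x y -> pairing linf_one y = 0.
Proof.
rewrite /gossez_op /= => Gyx; rewrite pairing_one; apply/eqP.
rewrite -oppr_eq0; apply/eqP.
have Gy0 : (G y : nat -> R) @ \oo --> (0 : R).
  have x0 : ((x : linf R) : nat -> R) @ \oo --> (0 : R).
    by have := valP x; rewrite inE.
  rewrite -[G y]opprK Gyx -oppr0; exact: cvgN.
exact: (cvg_unique _ (@G_cvg R y) Gy0).
Qed.

Lemma gossez_op_G y (y0 : pairing linf_one y = 0) :
  exists x : c0 R, - G y = x /\ gossez_op R x y.
Proof. by rewrite pairing_one in y0; exists (C0 (G_c0 y0)). Qed.

(** The functional [<w, .>] is bounded above on the subspace [ker s], hence zero there; testing it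
    on differences of consecutive unit vectors makes [w] constant. *)
Lemma gossez_closure_affine x y : gossez_closure (gossez_op R) x y ->
  exists c, x = - G y + c *: linf_one.
Proof.
move=> xy; pose w := x + G y.
(* Test against [(- G z, z)] in [T]: by skewness the inequality becomes linear in [z]. *)
have key z : pairing linf_one z = 0 -> pairing w z <= pairing x y.
  move=> /gossez_op_G[u [uE Tuz]].
  have /= := xy (u, z) Tuz; rewrite -uE /w.
  rewrite pairingBr !pairingBl !pairingNl pairingDl G_diag (G_skew y z); lra.
have wb n : pairing w (Defs.bump R n) = 0.
  have b0 t : pairing linf_one (t *: Defs.bump R n) = 0.
    by rewrite pairingZr pairing_bump subrr mulr0.
  apply/eqP/negP => /negP p0.
  (* This multiple of the bump pairs with [w] to [pairing x y + 1], above the bound. *)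
  have := key _ (b0 ((pairing x y + 1) / pairing w (Defs.bump R n))).
  by rewrite pairingZr divfK//; lra.
exists (w 0%N); have <- : w = w 0%N *: linf_one; last by rewrite /w addrCA addNr addr0.
apply/val_inj/funext => n; rewrite [RHS]mulr1.
elim: n => // n <-; apply/esym/eqP; rewrite -subr_eq0.
by have := wb n; rewrite pairing_bump => ->.
Qed.

Definition gossez_ext (k : R) : linf R -> set (ell1 R) :=
  fun x => [set y | x = - G y + (k * pairing linf_one y) *: linf_one].

Lemma gossez_ext_extends k : extends (gossez_ext k) (gossez_op R).
Proof.
move=> _ [[x y] /= Txy <-]; rewrite /graph /gossez_ext /=.
by rewrite (gossez_op_sum _ _ Txy) mulr0 scale0r addr0.
Qed.

Lemma delta0_subproof : (fun n => (n == 0)%:R : R) \in @ell1_pred R.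
Proof.
rewrite inE /=; apply/cvg_ex; exists 1; apply: cvg_near_cst.
exists 1%N => // -[//|n] _ /=.
rewrite seriesEnat /= big_nat_recl// normr1 big1 ?addr0// => i _.
by rewrite normr0.
Qed.

Definition delta0 : ell1 R := Ell1 delta0_subproof.

Lemma pairing_one_delta0 : pairing linf_one delta0 = 1.
Proof.
rewrite pairing_one; apply: cvg_lim => //; apply: cvg_near_cst.
exists 1%N => // -[//|n] _ /=.
by rewrite seriesEnat /= big_nat_recl// big1 ?addr0.
Qed.

Lemma gossez_ext_maximal (k : R) : 0 <= k ->
  maximal_monotone_linf (gossez_ext k).
Proof.
move=> k0; split=> [[x y] [x' y']|S Smon kS].
  rewrite /graph /gossez_ext /= => -> ->; rewrite pairing_affine.
  by rewrite -mulrBr -mulrA mulr_ge0// -expr2 sqr_ge0.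
apply/seteqP; split => //; case=> x y Sxy /=; rewrite /graph /gossez_ext /=.
have [|c xE] := gossez_closure_affine x y.
  move=> [u z] Tuz; apply: (Smon (x, y) (u : linf R, z)) => //.
  by apply: kS; apply: gossez_ext_extends; exists (u, z).
rewrite xE; congr (_ + _ *: _).
set s := pairing linf_one y; set d := c - k * s.
(* [d] is the offset of [(s, c)] from the line of slope [k]. Moving [y] by [- t *: delta0] reaches
   the point of that line over [s - t]. *)
have dt t : 0 <= (d + k * t) * t.
  pose z := y - t *: delta0.
  pose u : linf R := - G z + (k * pairing linf_one z) *: linf_one.
  have kuz : graph (gossez_ext k) (u, z) by [].
  have := Smon (x, y) (u, z) Sxy (kS _ kuz).
  rewrite /u xE /= pairing_affine /z pairingBr pairingZr pairing_one_delta0 -/s.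
  suff -> : (d + k * t) * t = (c - k * (s - t * 1)) * (s - (s - t * 1)) by [].
  by rewrite /d; ring.
apply/eqP; rewrite -subr_eq0 -/d; apply/eqP.
(* a [t] that makes the quadratic negative, also when [k = 0] *)
have := dt (- d / (k + 1)).
have k1 : k + 1 != 0 by lra.
have -> : (d + k * (- d / (k + 1))) * (- d / (k + 1)) = - (d / (k + 1)) ^+ 2.
  by field.
rewrite oppr_ge0 => d2.
have : d / (k + 1) == 0 by rewrite -sqrf_eq0 eq_le d2 sqr_ge0.
by rewrite mulf_eq0 invr_eq0 (negPf k1) orbF => /eqP.
Qed.

(** Since [s delta0 = 1], the slope is the coefficient of [e] in the point paired with [delta0]. *)
Lemma gossez_ext_inj : injective gossez_ext.
Proof.
move=> k l kl; pose x : linf R := - G delta0 + k *: linf_one.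
have : gossez_ext l x delta0.
  by rewrite -kl /gossez_ext /= pairing_one_delta0 mulr1.
rewrite /gossez_ext /= pairing_one_delta0 mulr1 => /addrI.
move=> /(congr1 (fun v : linf R => v 0%N)).
by rewrite -[LHS]/(k * 1) -[RHS]/(l * 1) !mulr1.
Qed.

Lemma gossez_op_not_type_D : ~ gossez_type_D (gossez_op R).
Proof.
move=> /(_ (- G delta0, delta0))[|I [le [u [v]]]].
  (* Both pairs have [c = 0], so they pair to zero. *)
  move=> [x y] Txy /=; rewrite (_ : pairing _ _ = 0)//.
  rewrite -Txy -[- G delta0]addr0 -[- G y]addr0 -(scale0r linf_one).
  by rewrite pairing_affine subrr mul0r.
(* Some [v i] is within distance less than 1 of [delta0], yet [s (delta0 - v i) = 1] and [s] has
   norm at most 1. *)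
move=> [[_ lexx _ _] Tuv _ _ /(_ _ (nbhsx_ballx _ 1 ltr01))[i _ /(_ i (lexx i))]].
rewrite /= -ball_normE /= => /(le_lt_trans (ler_norm_pairing_one _)).
by rewrite pairingBr pairing_one_delta0 (gossez_op_sum _ _ (Tuv i)) subr0 normr1 ltxx.
Qed.

End GossezExtensions.

Theorem proposition2p2 (R : realType) :
  infinite_set [set S : linf R -> set (ell1 R) |
                  maximal_monotone_linf S /\ extends S (gossez_op R)] /\
  ~ gossez_type_D (gossez_op R).
Proof.
split; last exact: gossez_op_not_type_D.
have : range (fun n : nat => gossez_ext R n%:R) `<=`
    [set S | maximal_monotone_linf S /\ extends S (gossez_op R)].
  move=> _ [n _ <-]; split; first exact: gossez_ext_maximal.
  exact: gossez_ext_extends.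
move=> /sub_infinite_set; apply.
rewrite (eq_finite_set (inj_card_eq _)); first exact: infinite_nat.
by move=> m n _ _ /gossez_ext_inj/eqP; rewrite eqr_nat => /eqP.
Qed.
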